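(* For all integers $k,n\geq 1$, $$J^k_n=J^{k-1}_n+\sum_{s=0}^{n-1}\binom{n}{s}J^{k-1}_s\,J^0_{n-s}.$$
   Context: Let $X_n=\{1,\dots,n\}$. A preferential arrangement of $X_n$ is an ordered set partition: a linearly ordered sequence of pairwise disjoint nonempty subsets (blocks) whose union is $X_n$. A barred preferential arrangement of $X_n$ with $m$ bars is a preferential arrangement of $X_n$ together with $m$ indistinguishable bars inserted into the sequence of blocks (before the first block, between blocks, or after the last block, several bars possibly in the same place). Equivalently, it is a sequence of $m+1$ sections $S_1,\dots,S_{m+1}$, where the $S_i$ are pairwise disjoint, possibly empty, subsets with union $X_n$, and each $S_i$ carries a preferential arrangement of its elements. $J^m_n$ denotes the number of barred preferential arrangements of $X_n$ with $m$ bars; $J^0_n$ is the number of preferential arrangements of $X_n$, and $J^m_0=1$. *)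

(* Defs.v *)
From mathcomp Require Import all_boot.

Set Implicit Arguments.
Unset Strict Implicit.
Unset Printing Implicit Defensive.

Definition pref_arr (T : finType) (s : seq {set T}) : bool :=
  [&& all (fun B => B != set0) s,
      pairwise (fun A B : {set T} => [disjoint A & B]) s
    & \bigcup_(B <- s) B == [set: T]].

(* [None] is a bar and [Some B] is the block [B]; [pmap id w] erases the bars. *)
Definition barred_pref_arr (T : finType) (m : nat)
    (w : seq (option {set T})) : bool :=
  (count_mem None w == m) && pref_arr (pmap id w).

Lemma size_pref_arr (T : finType) (s : seq {set T}) :
  pref_arr s -> size s <= #|T|.
Proof.
case/and3P=> nz dj /eqP covT; rewrite -cardsT -covT {covT}.
elim: s nz dj => [|B s IHs] //= /andP[nzB nz] /andP[djB dj].
have djU : B :&: \bigcup_(A <- s) A = set0.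
  rewrite big_distrr /= big1_seq // => A /= As.
  by apply/eqP; rewrite setI_eq0 (allP djB).
rewrite big_cons cardsU djU cards0 subn0.
by rewrite -add1n leq_add ?IHs // card_gt0.
Qed.

(* The length bound in [J] below therefore discards no arrangement. *)
Lemma size_barred_pref_arr (T : finType) (m : nat) (w : seq (option {set T})) :
  barred_pref_arr m w -> size w <= m + #|T|.
Proof.
case/andP=> /eqP <- /size_pref_arr; rewrite size_pmap.
rewrite -(count_predC (pred1 None) w) leq_add2l; apply: leq_trans.
by apply: sub_count => -[].
Qed.

(* The set {1, ..., n} is represented by ['I_n]. *)
Definition J (m n : nat) : nat :=
  #|[set w : {bseq (m + n) of option {set 'I_n}} | barred_pref_arr m w]|.

(* Main.v *)
(* Splitting a word at its first letter gives
     J m n = [m = n = 0] + J (m - 1) n + \sum_(j < n) 'C(n, j) * J m j,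
   where the middle term is present only for [m > 0] and [j] is the number of
   elements outside the first block.  Both sides of the theorem satisfy this
   recursion in [n], because 'C(n, j) 'C(j, s) = 'C(n, s) 'C(n - s, j - s). *)
Require Import Defs.
From mathcomp Require Import all_boot.

Set Implicit Arguments.
Unset Strict Implicit.
Unset Printing Implicit Defensive.

Lemma card_bseqS (X : finType) (L : nat) (P : pred (seq X)) :
  #|[set w : {bseq L.+1 of X} | P w]|
    = P [::] + \sum_(x : X) #|[set v : {bseq L of X} | P (x :: v)]|.
Proof.
rewrite -sum1_card (partition_big (fun w : {bseq _ of X} => ohead w) predT) //.
rewrite (bigD1 None) //=; congr (_ + _).
  (* Only the empty word has no head. *)
  rewrite (eq_bigl (fun w : {bseq L.+1 of X} => P [::] && (w == [bseq]))).
    by case: (P [::]); rewrite ?big_pred1_eq ?big_pred0_eq.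
  by case=> -[|x v] szv; rewrite inE -val_eqE //= !andbF.
rewrite (reindex_omap Some id) //=; last by case.
apply: eq_big => [x|x _]; first by rewrite eqxx.
rewrite sum1dep_card -[RHS](@card_imset _ _ (@cons_bseq L X x)); last first.
  by move=> u v /(congr1 val) [] /val_inj.
apply: eq_card => w; rewrite !inE; apply/andP/imsetP => [[Pw hw]|[v]].
  case: w => -[|y v] //= szv in Pw hw *.
  case/eqP: hw => <-; exists (Bseq (szv : size v <= L)).
    by rewrite inE.
  exact: val_inj.
by rewrite inE => Pv ->; rewrite /= eqxx.
Qed.

Section Partitions.

Variable T : finType.
Implicit Types (A B : {set T}) (s : seq {set T}) (w : seq (option {set T})).

(** The union is a subset [A] instead of all of [T], so that removing the first block leaves a
    problem of the same kind over the same type. *)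
Definition barred_pref_arr_on (m : nat) A w : bool :=
  (count_mem None w == m) &&
  [&& all (fun B => B != set0) (pmap id w),
      pairwise (fun B C : {set T} => [disjoint B & C]) (pmap id w)
    & \bigcup_(B <- pmap id w) B == A].

Lemma disjoint_bigcup_seq B s :
  all (fun C : {set T} => [disjoint B & C]) s
    = [disjoint B & \bigcup_(C <- s) C].
Proof.
elim: s => [|C s IHs] /=; first by rewrite big_nil -setI_eq0 setI0 eqxx.
by rewrite big_cons IHs -!setI_eq0 setIUr setU_eq0.
Qed.

Lemma setU_disjoint_eq A B (U : {set T}) :
  [disjoint B & U] && (B :|: U == A) = (B \subset A) && (U == A :\: B).
Proof.
apply/andP/andP => [[dBU /eqP <-]|[sBA /eqP ->]].
  rewrite subsetUl setDUl setDv set0U eq_sym; split=> //.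
  by apply/eqP/setDidPl; rewrite disjoint_sym.
rewrite -setI_eq0 setDE setICA setICr setI0 eqxx.
by rewrite setUIr setUCr setIT (setUidPr sBA) !eqxx.
Qed.

Lemma barred_pref_arr_on_bar m A w :
  barred_pref_arr_on m A (None :: w)
    = (0 < m) && barred_pref_arr_on m.-1 A w.
Proof. by rewrite /barred_pref_arr_on; case: m. Qed.

Lemma barred_pref_arr_on_block m A B w :
  barred_pref_arr_on m A (Some B :: w)
    = [&& B != set0, B \subset A & barred_pref_arr_on m (A :\: B) w].
Proof.
rewrite /barred_pref_arr_on /= add0n big_cons disjoint_bigcup_seq.
(* Disjointness from [B] and the covering of [A] combine into two conditions: [B] lies in [A], and
   the tail covers [A :\: B]. *)
have:= setU_disjoint_eq A B (\bigcup_(C <- pmap id w) C).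
case: (B != set0); last by rewrite andbF.
case: (count_mem None w == m); last by rewrite !andbF.
case: (all _ _); last by rewrite !andbF.
by case: (pairwise _ _); rewrite ?andbT ?andbF.
Qed.

Lemma sum_card_setD A (F : nat -> nat) :
  \sum_(B : {set T} | (B != set0) && (B \subset A)) F #|A :\: B|
    = \sum_(j < #|A|) 'C(#|A|, j) * F j.
Proof.
(* Complementation in [A] is an involution on its subsets that exchanges nonempty and proper
   ones. *)
rewrite (reindex_onto (fun D => A :\: D) (fun D => A :\: D)); last first.
  by move=> B /andP[_ /setIidPr sBA]; rewrite setDDr setDv set0U.
rewrite (eq_bigl (fun D : {set T} => D \proper A)); last first.
  move=> D; rewrite setDDr setDv set0U subsetDl andbT setD_eq0 properE andbC.
  by congr (_ && _); apply/eqP/setIidPr.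
rewrite (eq_bigr (fun D : {set T} => F #|D|)); last first.
  by move=> D /proper_sub /setIidPr; rewrite setDDr setDv set0U => ->.
rewrite -[RHS](big_mkord xpredT (fun j => 'C(#|A|, j) * F j)).
(* The one-term inner sum over [j = #|D|] prepares the exchange that groups the sets [D] by
   cardinality. *)
transitivity (\sum_(D : {set T} | D \proper A)
    \sum_(j < #|A| | #|D| == j :> nat) F j).
  apply: eq_bigr => D /proper_card ltD.
  by rewrite (big_pred1 (Ordinal ltD)) // => j; rewrite eq_sym.
rewrite (exchange_big_dep xpredT) //= big_mkord; apply: eq_bigr => j _.
rewrite sum_nat_const -cards_draws -cardsE; congr (_ * _).
apply: eq_card => D; rewrite inE unfold_in properEcard -andbA [RHS]inE.
congr (_ && _).
by case: eqP => [->|]; rewrite ?andbF // ltn_ord.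
Qed.

End Partitions.

(* The argument [L] bounds the length of the words being counted. *)
Fixpoint bpa_count (L m n : nat) : nat :=
  if L is L'.+1 then
    ((m == 0) && (n == 0)) + ((0 < m) * bpa_count L' m.-1 n
      + \sum_(j < n) 'C(n, j) * bpa_count L' m j)
  else (m == 0) && (n == 0).

Lemma barred_pref_arr_on_nil (T : finType) (m : nat) (A : {set T}) :
  barred_pref_arr_on m A [::] = (m == 0) && (#|A| == 0).
Proof.
by rewrite /barred_pref_arr_on /= big_nil eq_sym [set0 == _]eq_sym cards_eq0.
Qed.

(** Induction on [L] through the first letter: a bar lowers [m], a block [B] replaces [A] by
    [A :\: B]. *)
Lemma card_barred_pref_arr_on (T : finType) (L m : nat) (A : {set T}) :
  #|[set w : {bseq L of option {set T}} | barred_pref_arr_on m A w]|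
    = bpa_count L m #|A|.
Proof.
elim: L m A => [|L IHL] m A.
  rewrite /= -barred_pref_arr_on_nil -sum1dep_card /=.
  rewrite big_mkcond (big_pred1 [bseq]) /=.
    by case: (barred_pref_arr_on _ _ _).
  by case=> -[|x w] //=; rewrite -val_eqE.
rewrite card_bseqS barred_pref_arr_on_nil (bigD1 None) //=; congr (_ + (_ + _)).
  rewrite -IHL; case: m => [|m]; last first.
    by rewrite mul1n; apply: eq_card => w; rewrite !inE barred_pref_arr_on_bar.
  by apply: eq_card0 => w; rewrite inE barred_pref_arr_on_bar.
rewrite (reindex_omap Some id) /=; last by case.
rewrite (eq_bigl xpredT); last by move=> B; rewrite eqxx.
rewrite -(sum_card_setD A (bpa_count L m)) [RHS]big_mkcond.
apply: eq_bigr => B _; rewrite -IHL; case: ifP => nzB.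
  by apply: eq_card => w; rewrite !inE barred_pref_arr_on_block andbA nzB.
by apply: eq_card0 => w; rewrite inE barred_pref_arr_on_block andbA nzB.
Qed.

Lemma bpa_countS (L m n : nat) :
  bpa_count L.+1 m n = ((m == 0) && (n == 0)) + ((0 < m) * bpa_count L m.-1 n
    + \sum_(j < n) 'C(n, j) * bpa_count L m j).
Proof. by []. Qed.

(** Each recursive call lowers [m + n], so such a bound lasts until [m = n = 0], where the value is
    1 for every bound. *)
Lemma bpa_count_fuel (L m n : nat) :
  m + n <= L -> bpa_count L.+1 m n = bpa_count L m n.
Proof.
elim: L m n => [|L IHL] m n le_mnL.
  move: le_mnL; rewrite leqn0 addn_eq0 => /andP[/eqP-> /eqP->].
  by rewrite /= big_ord0.
rewrite bpa_countS [RHS]bpa_countS; congr (_ + (_ + _)).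
  by case: m le_mnL => [|m] // le_mnL; rewrite IHL.
apply: eq_bigr => j _; rewrite IHL //.
by rewrite -ltnS (leq_trans _ le_mnL) // ltn_add2l.
Qed.

Lemma J_bpa_count (L m n : nat) : m + n <= L -> J m n = bpa_count L m n.
Proof.
move/subnKC <-; elim: (L - _) => [|d IHd].
  have := card_barred_pref_arr_on (m + n) m [set: 'I_n].
  by rewrite cardsT card_ord addn0.
by rewrite addnS bpa_count_fuel ?leq_addr.
Qed.

Lemma J_rec (m n : nat) :
  J m n = ((m == 0) && (n == 0)) + ((0 < m) * J m.-1 n
            + \sum_(j < n) 'C(n, j) * J m j).
Proof.
(* Unfolding once from [(m + n).+1] leaves the bound [m + n], still large enough for every term on
   the right. *)
rewrite (@J_bpa_count (m + n).+1) // bpa_countS; congr (_ + (_ + _)).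
  by rewrite -J_bpa_count // leq_add2r leq_pred.
by apply: eq_bigr => j _; rewrite -J_bpa_count // leq_add2l ltnW.
Qed.

Lemma J0_rec (n : nat) : 0 < n -> J 0 n = \sum_(0 <= j < n) 'C(n, j) * J 0 j.
Proof. by case: n => // n _; rewrite J_rec /= !add0n big_mkord. Qed.

Lemma J00 : J 0 0 = 1.
Proof. by rewrite J_rec big_ord0. Qed.

Lemma JS_rec (m n : nat) :
  J m.+1 n = J m n + \sum_(0 <= j < n) 'C(n, j) * J m.+1 j.
Proof. by rewrite J_rec /= add0n mul1n big_mkord. Qed.

Lemma bin_revision (n j s : nat) : s <= j -> j <= n ->
  'C(n, j) * 'C(j, s) = 'C(n, s) * 'C(n - s, j - s).
Proof.
move=> le_sj le_jn; have le_sn := leq_trans le_sj le_jn.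
(* Multiplied by this product, either side becomes the factorial of [n]. *)
have f_gt0 : 0 < s`! * (j - s)`! * (n - j)`! by rewrite !muln_gt0 !fact_gt0.
apply/eqP; rewrite -(eqn_pmul2r f_gt0); apply/eqP.
transitivity n`!.
  by rewrite -(bin_fact le_jn) -(bin_fact le_sj) -!mulnA.
rewrite -(bin_fact le_sn) -(bin_fact (leq_sub2r s le_jn)).
have -> : n - s - (j - s) = n - j by rewrite subnBA // subnK.
by rewrite -!mulnA; congr (_ * _); rewrite mulnCA.
Qed.

(** Combinatorially, [s] is the number of elements before the last bar; the proof instead compares
    recursions in [n]. *)
Lemma JS_conv (m n : nat) :
  J m.+1 n = \sum_(0 <= s < n.+1) 'C(n, s) * J m s * J 0 (n - s).
Proof.
elim/ltn_ind: n => n IHn.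
(* The term [s = n] is the [J m n] of the recursion, since [J 0 0 = 1]. *)
rewrite JS_rec big_nat_recr //= binn subnn J00 mul1n muln1 addnC; congr (_ + _).
(* The range of [s] is widened to [n] under a guard so that the two sums can be exchanged. *)
transitivity (\sum_(0 <= j < n) \sum_(0 <= s < n | s < j.+1)
    'C(n, s) * J m s * ('C(n - s, j - s) * J 0 (j - s))).
  rewrite !big_nat; apply: eq_bigr => j /= lt_jn.
  rewrite IHn // big_distrr /= (big_nat_widen _ _ n) //.
  rewrite big_nat_cond [RHS]big_nat_cond; apply: eq_bigr => s /= /andP[_ le_sj].
  rewrite !mulnA bin_revision ?(ltnW lt_jn) //.
  by rewrite -!mulnA; congr (_ * _); rewrite mulnCA.
rewrite (exchange_big_dep_nat xpredT) //= !big_nat; apply: eq_bigr => s /= lt_sn.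
(* For fixed [s], the sum over [j - s] is the recursion for [J 0 (n - s)]. *)
rewrite J0_rec ?subn_gt0 // -big_distrr /=; congr (_ * _).
rewrite -(@big_nat_widenl _ _ _ s 0 n xpredT) // -[s in LHS]add0n big_addn.
by apply: eq_bigr => j _; rewrite add0n addnK.
Qed.

Theorem theorem2 (k n : nat) (hk : 1 <= k) (hn : 1 <= n) :
  J k n = J (k - 1) n + \sum_(0 <= s < n) 'C(n, s) * J (k - 1) s * J 0 (n - s).
Proof.
(* The isolated summand of the claim is the term [s = n] of the convolution. *)
case: k hk => // k _; rewrite subn1 /= JS_conv big_nat_recr //=.
by rewrite binn subnn J00 mul1n muln1 addnC.
Qed.
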